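(* Let $n\ge 4$. There exists a symmetric shelling order of $\Delta^3_n$, i.e. an ordering of its facets of the form $(F_1,F_2,\dots,F_m,-F_m,-F_{m-1},\dots,-F_1)$ that is a shelling order.
   Context: Simplicial complexes are finite abstract simplicial complexes; $\overline{A}$ is the simplex of all subsets of a finite set $A$. $V_m=\{\pm1,\dots,\pm m\}$; $-\sigma=\{-v:v\in\sigma\}$, $-\Gamma=\{-\sigma:\sigma\in\Gamma\}$. The join is $\Gamma*\Gamma'=\{\sigma\cup\tau\}$, $\Gamma*v:=\Gamma*\overline{\{v\}}$; a path/cycle $(v_1,\dots,v_m)$ is the 1-dimensional complex with edges $\{v_j,v_{j+1}\}$. $\partial C^*_m$ is the complex of all subsets of $V_m$ with no pair $\{j,-j\}$. For pure $\Delta$ and pure full-dimensional subcomplex $\Gamma$, $\Delta\setminus\Gamma$ is generated by facets of $\Delta$ not in $\Gamma$; $\partial B$ is the boundary of a combinatorial ball $B$. Recursive definition: $\Delta^1_n=(1,\dots,n,-1,\dots,-n,1)$; $\Delta^d_{d+1}=\partial C^*_{d+1}$; $B^{d,j}_n=\emptyset$ for $j<0$; $B^{1,0}_n=\overline{\{-1,n\}}$; $B^{2k-1,k}_n=\Delta^{2k-1}_n\setminus B^{2k-1,k-1}_n$ ($k\ge1$, $n\ge 2k$); $B^{d,i}_n=(B^{d-1,i}_{n-1}*n)\cup((-B^{d-1,i-1}_{n-1})*(-n))$ ($d\ge2$, $n\ge d+1$, $i\le\lfloor d/2\rfloor$); $\Delta^d_{n+1}$ is obtained from $\Delta^d_n$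 by replacing $B=B^{d,\lceil d/2\rceil-1}_n$ with $\partial B*(n+1)$ and $-B$ with $\partial(-B)*(-n-1)$ (known to be well defined). An ordering $(G_1,\dots,G_r)$ of the facets of a pure $d$-dimensional complex is a shelling order if for every $2\le t\le r$, $\overline{G_t}\cap\bigcup_{s<t}\overline{G_s}$ is pure of dimension $d-1$. *)

(* Defs.v *)
From HB Require Import structures.
From mathcomp Require Import all_boot all_order all_algebra.
From mathcomp Require Import finmap.

Set Implicit Arguments.
Unset Strict Implicit.
Unset Printing Implicit Defensive.

Import Order.TTheory GRing.Theory Num.Theory.
Local Open Scope ring_scope.
Local Open Scope fset_scope.

(** Vertices are (nonzero) integers.  A complex is the finite set of all its
    faces, the empty face included; [fset0] is the void complex. *)
Definition face := {fset int}.
Definition complex := {fset face}.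

Definition simplex (A : face) : complex := fpowerset A.

Definition generated (s : seq face) : complex := \bigcup_(A <- s) simplex A.

Definition facets (K : complex) : {fset face} :=
  [fset A in K | [forall B : K, (A `<=` val B) ==> (val B == A)]].

(** [pure k K]: K is pure of dimension [k - 1]; indexing by the cardinality of
    the facets avoids the dimension -1 of the complex whose only face is the
    empty one. *)
Definition pure (k : nat) (K : complex) : Prop :=
  K != fset0 /\ forall A, A \in facets K -> #|` A| = k.

Definition neg_face (A : face) : face := [fset - v | v in A].
Definition neg_complex (K : complex) : complex := [fset neg_face A | A in K].

Definition join (K L : complex) : complex := [fset A `|` B | A in K, B in L].
Definition cone (K : complex) (v : int) : complex := join K (simplex [fset v]).

Definition diffc (K L : complex) : complex :=
  generated [seq A <- facets K | A \notin L].

(** The boundary of a pure complex that is a combinatorial ball: the subcomplex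
    generated by the codimension-one faces that lie in exactly one facet. *)
Definition boundary (K : complex) : complex :=
  generated [seq A <- K |
    #|` [fset G in facets K | (A `<=` G) && (#|` G| == #|` A|.+1)]| == 1%N].

(** Vertices [v1; ...; vm] in order; for a cycle, v1 is repeated at the end. *)
Definition path_complex (s : seq int) : complex :=
  generated [seq [fset e.1; e.2] | e <- zip s (behead s)].

Definition poss (m : nat) : seq int := [seq j%:Z | j <- iota 1 m].
Definition negs (m : nat) : seq int := [seq - j%:Z | j <- iota 1 m].

Definition V (m : nat) : face := [fset v in poss m ++ negs m].

Definition cross_boundary (m : nat) : complex :=
  [fset A in fpowerset (V m) | [forall v : A, - val v \notin A]].

(** The families Delta^d_n and B^{d,i}_n are mutually recursive; to obtain
    structural recursions, the two recursive steps are first stated for a given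
    family of balls.  The equations [Delta1E] to [B_complE] below are the
    defining equations of the resulting families. *)

Definition replace_balls (K B : complex) (n : nat) : complex :=
  diffc K (B `|` neg_complex B)
    `|` cone (boundary B) n.+1%:Z
    `|` cone (boundary (neg_complex B)) (- n.+1%:Z).

(** Delta^d_n computed from the balls B^{d,ceil(d/2)-1}_m, m < n.  The value for
    [n < d + 1] is irrelevant. *)
Fixpoint Delta_of (d : nat) (ball : nat -> complex) (n : nat) : complex :=
  if n is m.+1 then
    if (m <= d)%N then cross_boundary d.+1
    else replace_balls (Delta_of d ball m) (ball m) m
  else cross_boundary d.+1.

(** B^{d,i}_n computed from the family B^{d-1,i}_n; for [i = 0] the second part
    is the join with B^{d-1,-1}_(n-1), which is void. *)
Definition B_step (Bd' : nat -> nat -> complex) (i n : nat) : complex :=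
  cone (Bd' i n.-1) n%:Z
    `|` (if i is i'.+1 then cone (neg_complex (Bd' i' n.-1)) (- n%:Z)
         else fset0).

Definition Delta1 (n : nat) : complex :=
  path_complex (poss n ++ negs n ++ [:: 1]).

Definition B10 (n : nat) : complex := simplex [fset -1; n%:Z].

(** Meaningful for [d >= 1], [n >= d + 1] and [i <= ceil(d/2)]; note that
    [uphalf d = k] and [(uphalf d).-1 = k - 1 = floor(d/2)] for [d = 2k - 1]. *)
Fixpoint B (d : nat) : nat -> nat -> complex :=
  match d with
  | 0 => fun _ _ => fset0
  | 1 => fun i n => if i == 0%N then B10 n else diffc (Delta1 n) (B10 n)
  | d'.+1 => fun i n =>
      let Bd := B_step (B d') in
      let c := uphalf d in
      if odd d && (i == c)
      then diffc (Delta_of d (Bd c.-1) n) (Bd c.-1 n)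
      else Bd i n
  end.

Definition Delta (d n : nat) : complex :=
  if d == 1%N then Delta1 n else Delta_of d (B d (uphalf d).-1) n.

Lemma Delta1E n : Delta 1 n = path_complex (poss n ++ negs n ++ [:: 1]).
Proof. by []. Qed.

Lemma Delta_crossE d : (2 <= d)%N -> Delta d d.+1 = cross_boundary d.+1.
Proof. by case: d => [|[|d]] //= _; rewrite /Delta /= leqnn. Qed.

Lemma Delta_replaceE d n : (2 <= d)%N -> (d.+1 <= n)%N ->
  Delta d n.+1 = replace_balls (Delta d n) (B d (uphalf d).-1 n) n.
Proof.
by case: d => [|[|d]] // _ ltdn; rewrite /Delta [LHS]/= leqNgt ltdn.
Qed.

Lemma B10E n : B 1 0 n = simplex [fset -1; n%:Z].
Proof. by []. Qed.

Lemma B_joinE d i n : (2 <= d)%N -> (i <= d./2)%N ->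
  B d i n = cone (B d.-1 i n.-1) n%:Z
    `|` (if i is i'.+1 then cone (neg_complex (B d.-1 i' n.-1)) (- n%:Z)
         else fset0).
Proof.
case: d => [|[|d]] // _ lei; rewrite [LHS]/=.
case: ifP => // /andP[odd_d /eqP def_i]; move: lei.
have -> : d.+2./2 = (uphalf d.+2).-1 by rewrite [in RHS]uphalf_half /= odd_d.
by rewrite {1}def_i /= ltnn.
Qed.

Lemma eq_Delta_of d b1 b2 n : b1 =1 b2 -> Delta_of d b1 n = Delta_of d b2 n.
Proof. by move=> eq_b; elim: n => //= n ->; rewrite eq_b. Qed.

Lemma B_complE k n : (1 <= k)%N ->
  B k.*2.-1 k n = diffc (Delta k.*2.-1 n) (B k.*2.-1 k.-1 n).
Proof.
case: k => [|[|k]] // _; rewrite doubleS -[_.+2.-1]/(k.*2.+3).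
have odd_d : odd k.*2.+3 by rewrite /= odd_double.
have up_d : uphalf k.*2.+3 = k.+2 by rewrite /= doubleK.
have BE m : B k.*2.+3 k.+1 m = B_step (B k.*2.+2) k.+1 m.
  rewrite [LHS]/=; case: ifP => // /andP[_ /eqP].
  by rewrite -[X in _ = X -> _]/(uphalf k.*2.+3) up_d => /n_Sn.
rewrite /Delta up_d (eq_Delta_of _ _ BE) BE.
have -> m : B k.*2.+3 k.+2 m =
    if odd k.*2.+3 && (k.+2 == uphalf k.*2.+3)
    then diffc (Delta_of k.*2.+3 (B_step (B k.*2.+2) (uphalf k.*2.+3).-1) m)
               (B_step (B k.*2.+2) (uphalf k.*2.+3).-1 m)
    else B_step (B k.*2.+2) k.+2 m by [].
by rewrite odd_d up_d eqxx.
Qed.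

(** [s] is a shelling order of the pure [d]-dimensional complex [K]. *)
Definition shelling_order (d : nat) (K : complex) (s : seq face) : Prop :=
  [/\ pure d.+1 K,
      perm_eq s (facets K) &
      forall t : nat, (0 < t < size s)%N ->
        pure d (simplex (nth fset0 s t) `&` generated (take t s))].

(* Main.v *)
Require Import Defs.
From mathcomp Require Import all_boot all_order all_algebra finmap zify.

(** The facets of [Delta 3 n] are split into a half [F] and its antipode.  Put the
    ball [B 3 1 n] first in [F]; it is a stacked ball whose dual graph is a tree.
    Then take, for [k = n - 1, ..., 4], the facets of the cone over the boundary
    of [B 3 1 k] which belong neither to [B 3 1 k.+1] nor to its antipode, and
    finally three facets of the cross-polytope.  To each facet [G] of [F] one
    attaches a face [R] of [G] contained in no earlier facet of [F] such that
    [G `\` R] is contained in no later facet of [F] and in no antipode of a facet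
    of [F].  As every ridge lies in a second facet, this forces [R] to be the
    restriction face of [G], and [- (G `\` R)] to be that of [- G] in the second
    half of the order. *)

Set Implicit Arguments.
Unset Strict Implicit.
Unset Printing Implicit Defensive.

Import Order.TTheory GRing.Theory Num.Theory.
Local Open Scope fset_scope.
Local Open Scope ring_scope.

(** * Facets as explicit families of vertex lists *)

(** The edges of the path (-1, ..., -m, 1, ..., m).  Here and below the vertices
    of a face are listed by increasing absolute value. *)
Variant edge (m p q : int) : Prop :=
| EdgeUp of 1 <= p < m & q = p + 1
| EdgeMid of p = 1 & q = - m
| EdgeDown of - m < p <= -1 & q = p - 1.

(** The facets of [B 3 1 n]. *)
Variant ball (n p q r s : int) : Prop :=
| BallEdge of edge (n - 2) p q & r = n - 1 & s = n
| BallTop of p = 1 & q = 2 - n & r = 1 - n & s = n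
| BallBot of p = 1 & q = 2 - n & r = 1 - n & s = - n.

(** For [5 <= s], facets of the cone with apex [s] over the boundary of
    [B 3 1 (s - 1)]; the last three come from the cross-polytope. *)
Variant rest (n p q r s : int) : Prop :=
| RestEdge of 5 <= s <= n & edge (s - 3) p q & r = s - 2
| RestMid of 5 <= s <= n & p = 1 & q = 3 - s & r = 1 - s
| RestDown of 5 <= s <= n & p = 3 - s & q = 2 - s & r = 1 - s
| RestC1 of p = 1 & q = - 2 & r = 3 & s = - 4
| RestC2 of p = 1 & q = 2 & r = 3 & s = - 4
| RestC3 of p = 1 & q = 2 & r = - 3 & s = 4.

Definition hemisphere n p q r s := ball n p q r s \/ rest n p q r s.

(** The facets of [Delta 3 n]. *)
Definition sphere n p q r s :=
  hemisphere n p q r s \/ hemisphere n (- p) (- q) (- r) (- s).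

(** The facets of the boundary of [B 3 1 n]. *)
Variant ball_bd (n p q r : int) : Prop :=
| BdEdge1 of edge (n - 2) p q & r = n - 1
| BdEdge of edge (n - 2) p q & p <> 1 \/ q <> 2 - n & r = n
| BdEnd of p = -1 \/ p = n - 2 & q = n - 1 & r = n
| BdTip of p = 1 \/ p = 2 - n & q = 1 - n & r = n \/ r = - n
| BdLast of p = 1 & q = 2 - n & r = - n.

(** The tetrahedron [p q r s] has rank [i] in the block [l] of [F]; [R] lists the
    vertices of its restriction face, [N] the other ones.  The blocks come in
    decreasing order of [l]: [B 3 1 n] is the block [n + 1], followed by the
    facets of [rest] with largest vertex [l] for [l = n, ..., 5], and by those of
    the cross-polytope.  In each block the path is followed backwards. *)
Variant step_at (n l i p q r s : int) : seq int -> seq int -> Prop :=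
| StepFirst of l = n + 1 & i = 0 & p = n - 3 & q = n - 2 & r = n - 1 & s = n :
    step_at n l i p q r s [::] [:: p; q; r; s]
| StepBallUp of l = n + 1 & i = n - 3 - p & 1 <= p < n - 3 & q = p + 1
    & r = n - 1 & s = n :
    step_at n l i p q r s [:: p] [:: q; r; s]
| StepBallMid of l = n + 1 & i = n - 3 & p = 1 & q = 2 - n & r = n - 1 & s = n :
    step_at n l i p q r s [:: q] [:: p; r; s]
| StepBallDown of l = n + 1 & i = n + n - 5 + p & 2 - n < p <= -1
    & q = p - 1 & r = n - 1 & s = n :
    step_at n l i p q r s [:: p] [:: q; r; s]
| StepBallTop of l = n + 1 & i = n + n - 5 & p = 1 & q = 2 - n & r = 1 - n
    & s = n :
    step_at n l i p q r s [:: r] [:: p; q; s]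
| StepBallBot of l = n + 1 & i = n + n - 4 & p = 1 & q = 2 - n & r = 1 - n
    & s = - n :
    step_at n l i p q r s [:: s] [:: p; q; r]
| StepRestDown of 5 <= l <= n & i = 0 & p = 3 - l & q = 2 - l & r = 1 - l
    & s = l :
    step_at n l i p q r s [:: p; r] [:: q; s]
| StepRestMid of 5 <= l <= n & i = 1 & p = 1 & q = 3 - l & r = 1 - l & s = l :
    step_at n l i p q r s [:: p; q] [:: r; s]
| StepEdgeUp of 5 <= l <= n & i = l - 2 - p & 1 <= p < l - 3 & q = p + 1
    & r = l - 2 & s = l :
    step_at n l i p q r s [:: p; r] [:: q; s]
| StepEdgeMid of 5 <= l <= n & i = l - 2 & p = 1 & q = 3 - l & r = l - 2
    & s = l :
    step_at n l i p q r s [:: q; r] [:: p; s]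
| StepEdgeDown of 5 <= l <= n & i = l + l - 5 + p & 3 - l < p <= - 1
    & q = p - 1 & r = l - 2 & s = l :
    step_at n l i p q r s [:: p; r] [:: q; s]
| StepC1 of l = 4 & i = 0 & p = 1 & q = - 2 & r = 3 & s = - 4 :
    step_at n l i p q r s [:: r; s] [:: p; q]
| StepC2 of l = 4 & i = 1 & p = 1 & q = 2 & r = 3 & s = - 4 :
    step_at n l i p q r s [:: q; s] [:: p; r]
| StepC3 of l = 4 & i = 2 & p = 1 & q = 2 & r = - 3 & s = 4 :
    step_at n l i p q r s [:: q; r] [:: p; s].

(** * Case analysis by linear arithmetic *)

Ltac split_hyps := repeat match goal with
 | H : edge _ _ _ |- _ => destruct H
 | H : ball _ _ _ _ _ |- _ => destruct H
 | H : rest _ _ _ _ _ |- _ => destruct H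
 | H : hemisphere _ _ _ _ _ |- _ => destruct H
 | H : sphere _ _ _ _ _ |- _ => destruct H
 | H : ball_bd _ _ _ _ |- _ => destruct H
 | H : step_at _ _ _ _ _ _ _ _ _ |- _ => destruct H
 | H : _ \/ _ |- _ => destruct H
 end.

Ltac fin := lazymatch goal with
 | |- edge _ _ _ => first [assumption | by constructor 1; lia
      | by constructor 2; lia | by constructor 3; lia]
 | |- ball _ _ _ _ _ => first [constructor 1; [|lia|lia]; fin
      | by constructor 2; lia | by constructor 3; lia]
 | |- rest _ _ _ _ _ => first [constructor 1; [lia| |lia]; fin
      | by constructor 2; lia | by constructor 3; lia | by constructor 4; lia
      | by constructor 5; lia | by constructor 6; lia]
 | |- ball_bd _ _ _ _ => first [constructor 1; [|lia]; fin
      | constructor 2; [|lia|lia]; fin | by constructor 3; lia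
      | by constructor 4; lia | by constructor 5; lia]
 | |- hemisphere _ _ _ _ _ => first [left; fin | right; fin]
 | |- sphere _ _ _ _ _ => first [left; fin | right; fin]
 | |- _ => lia
 end.

Lemma sphere_sorted n p q r s : 4 <= n -> sphere n p q r s ->
  [/\ 0 < `|p|, (`|p| < `|q|) && (`|q| < `|r| < `|s|) & `|s| <= n].
Proof. by move=> hn H; split_hyps; split; lia. Qed.

Lemma sphere4 (p q r s : int) : `|p| = 1 -> `|q| = 2 -> `|r| = 3 -> `|s| = 4 ->
  sphere 4 p q r s.
Proof.
move=> hp hq hr hs.
have [->|->] : p = 1 \/ p = -1 by lia.
all: have [->|->] : q = 2 \/ q = -2 by lia.
all: have [->|->] : r = 3 \/ r = -3 by lia.
all: have [->|->] : s = 4 \/ s = -4 by lia.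
all: fin.
Qed.

Lemma cone_sphere_succ n p q r : 4 <= n -> ball_bd n p q r ->
  sphere (n + 1) p q r (n + 1).
Proof. by move=> hn h; split_hyps; fin. Qed.

Lemma rest_sphere_succ n p q r s : 4 <= n -> rest n p q r s ->
  sphere (n + 1) p q r s.
Proof. by move=> hn h; split_hyps; fin. Qed.

(** This is the replacement of the two balls by cones, read off on facets. Only [BallBot] of the new
    ball falls in the cone with apex [- (n + 1)]. *)
Lemma hemisphere_succ n p q r s : 4 <= n -> hemisphere (n + 1) p q r s ->
  [\/ rest n p q r s, s = n + 1 /\ ball_bd n p q r |
      s = - (n + 1) /\ ball_bd n (- p) (- q) (- r)].
Proof.
move=> hn h; have [hs|hs] : s = n + 1 \/ s <> n + 1 by lia.
(* The edges starting at [n - 2] or [2 - n] belong to the path of the new ball but not to that of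
   the old one; they give [BdEnd] and [BdTip] instead of [BdEdge]. *)
all: have [hp|[hp|hp]] :
  p = n - 2 \/ p = 2 - n \/ (p <> n - 2 /\ p <> 2 - n) by lia.
all: split_hyps; try (exfalso; lia).
all: first [by constructor 2; split; [lia | fin]
  | by constructor 3; split; [lia | fin] | by constructor 1; fin].
Qed.

(** For an edge step with [5 <= l <= n], [R] consists of [l - 2] and the path vertex just reached.
    Facets of earlier blocks contain [l - 2] only in their path edge, whose other end is [l - 3] or
    [l - 1], never in [R]; earlier facets of the same block miss the new path vertex or [l - 2]. *)
Lemma step_before n l i p q r s R N l' i' p' q' r' s' R' N' : 4 <= n ->
  step_at n l i p q r s R N -> step_at n l' i' p' q' r' s' R' N' ->
  (l < l') || (l == l') && (i' < i) ->
  all (mem [:: p'; q'; r'; s']) R -> False.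
Proof. by move=> hn h h' hb; split_hyps; rewrite /= ?inE => hm; lia. Qed.

(** For [5 <= l <= n], [N] contains [l], which exceeds all vertices of the later blocks, and another
    vertex that the remaining facets of its block avoid. *)
Lemma step_after n l i p q r s R N l' i' p' q' r' s' R' N' : 4 <= n ->
  step_at n l i p q r s R N -> step_at n l' i' p' q' r' s' R' N' ->
  (l' < l) || (l == l') && (i < i') ->
  all (mem [:: p'; q'; r'; s']) N -> False.
Proof. by move=> hn h h' hb; split_hyps; rewrite /= ?inE => hm; lia. Qed.

(** The two codes are not compared: the whole first half precedes every antipode, so [N] has to be
    missed by all antipodes. *)
Lemma step_opp n l i p q r s R N l' i' p' q' r' s' R' N' : 4 <= n ->
  step_at n l i p q r s R N -> step_at n l' i' p' q' r' s' R' N' ->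
  all (mem [:: - p'; - q'; - r'; - s']) N -> False.
Proof. by move=> hn h h'; split_hyps; rewrite /= ?inE => hm; lia. Qed.

Lemma sphere_opp n p q r s : sphere n p q r s -> sphere n (- p) (- q) (- r) (- s).
Proof. by case; [right; rewrite !opprK | left]. Qed.

(** * Ridges of the ball and its boundary surface *)

(** Both lists increase strictly in absolute value, so the triple omits one of the four entries and
    keeps their order. *)
Lemma sorted_sub (a b c p q r s : int) : `|a| < `|b| < `|c| ->
    (`|p| < `|q|) && (`|q| < `|r| < `|s|) ->
    all (mem [:: p; q; r; s]) [:: a; b; c] ->
  [\/ [/\ a = p, b = q & c = r], [/\ a = p, b = q & c = s],
      [/\ a = p, b = r & c = s] | [/\ a = q, b = r & c = s]].
Proof.
rewrite /= !inE => h1 h2 /and4P[/or4P ha /or4P hb /or4P hc _].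
by case: ha => /eqP ea; case: hb => /eqP eb; try (exfalso; lia);
  case: hc => /eqP ec; try (exfalso; lia);
  [constructor 1 | constructor 2 | constructor 3 | constructor 4].
Qed.

Lemma bd_sorted n a b c : 4 <= n -> ball_bd n a b c -> `|a| < `|b| < `|c|.
Proof. by move=> hn h; split_hyps; lia. Qed.

Lemma ball_sorted n p q r s : 4 <= n -> ball n p q r s ->
  (`|p| < `|q|) && (`|q| < `|r| < `|s|).
Proof. by move=> hn h; have [] := sphere_sorted hn (or_introl (or_introl h)). Qed.

Lemma bd_ball n a b c : 4 <= n -> ball_bd n a b c ->
  exists p q r s, [/\ ball n p q r s, all (mem [:: p; q; r; s]) [:: a; b; c] &
    forall p' q' r' s', ball n p' q' r' s' ->
      all (mem [:: p'; q'; r'; s']) [:: a; b; c] ->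
      [/\ p' = p, q' = q, r' = r & s' = s]].
Proof.
move=> hn bd; have ha := bd_sorted hn bd.
suff [p [q [r [s [h hm uq]]]]] : exists p q r s,
    [/\ ball n p q r s, all (mem [:: p; q; r; s]) [:: a; b; c] &
    forall p' q' r' s', ball n p' q' r' s' -> [\/ [/\ a = p', b = q' & c = r'],
      [/\ a = p', b = q' & c = s'], [/\ a = p', b = r' & c = s'] |
      [/\ a = q', b = r' & c = s']] -> [/\ p' = p, q' = q, r' = r & s' = s]].
  exists p, q, r, s; split=> // p' q' r' s' h' hm'.
  exact: uq (sorted_sub ha (ball_sorted hn h') hm').
(* The vertex completing each type of triangle: [n]; [n - 1]; the path neighbour of the end [-1] or
   [n - 2]; the missing one of [1], [2 - n]; and [1 - n]. *)
case: bd => [e hc|e he hc|[h|h] hb hc|h hb hc|h hb hc];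
  [exists a, b, c, n | exists a, b, (n - 1), c | exists (-1), (-2), b, c
  | exists (n - 3), (n - 2), b, c | exists 1, (2 - n), b, c
  | exists 1, (2 - n), (1 - n), c].
all: rewrite /= !inE; split;
  [by split_hyps; fin | by lia | move=> p' q' r' s' h' hm].
all: case: hm => -[ea eb ec]; split_hyps; try (exfalso; lia).
all: split; lia.
Qed.

(** The second alternative says that the ridge is interior to the ball as seen in the whole sphere:
    no facet outside the ball contains it. *)
Definition ridge_spec n (T : Prop) (t : seq int) :=
  T \/ forall p q r s, sphere n p q r s -> all (mem [:: p; q; r; s]) t ->
    ball n p q r s.

Lemma ball_ridges n p q r s : 4 <= n -> ball n p q r s ->
  [/\ ridge_spec n (ball_bd n q r s) [:: q; r; s],
      ridge_spec n (ball_bd n p r s) [:: p; r; s],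
      ridge_spec n (ball_bd n p q s) [:: p; q; s] &
      ridge_spec n (ball_bd n p q r) [:: p; q; r]].
Proof.
move=> hn h.
(* The cases single out the end edges of the path, where [{n - 2, n - 1, n}] and [{-1, n - 1, n}]
   are boundary ridges. *)
have [hp'|[hp'|[hp1 hp2]]] :
  p = n - 3 \/ p = -1 \/ (p <> n - 3 /\ p <> -1) by lia.
all: split_hyps; try (exfalso; lia).
all: split; first [left; fin | right=> p' q' r' s' h' /sorted_sub hm;
  have [_ hs _] := sphere_sorted hn h'; have {}hm := hm ltac:(lia) hs].
all: case: hm => -[ea eb ec]; split_hyps; first [exfalso; lia | fin].
Qed.

Definition bd_nb n (v : int) (t : seq int) :=
  exists a b c,
    [/\ ball_bd n a b c, all (mem [:: a; b; c]) t & v \notin [:: a; b; c]].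

Ltac nb x y z := exists x, y, z; rewrite /= !inE; split; [fin | lia | lia].

(** Closedness of the boundary surface; after coning it supplies second facets on the ridges that
    contain the apex. *)
Lemma bd_neighbours n (a b c : int) : 4 <= n -> ball_bd n a b c ->
  [/\ bd_nb n a [:: b; c], bd_nb n b [:: a; c] & bd_nb n c [:: a; b]].
Proof.
move=> hn [[ha hb|ha hb|ha hb] hc|[ha hb|ha hb|ha hb] hab hc|[ha|ha] hb hc
  |[ha|ha] hb [hc|hc]|ha hb hc].
- split; last by nb a b n.
    have [h|h] : a = n - 3 \/ a < n - 3 by lia.
      by nb b c n.
    by nb b (b + 1) c.
  have [h|h] : a = 1 \/ 1 < a by lia.
    by nb a (2 - n) c.
  by nb (a - 1) a c.
- split; [nb (3 - n) b c | nb a 2%:Z c | nb a b (- n)].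
- split; last by nb a b n.
    have [h|h] : b = 2 - n \/ 2 - n < b by lia.
      by nb 1%:Z b c.
    by nb b (b - 1) c.
  have [h|h] : a = -1 \/ a < -1 by lia.
    by nb a c n.
  by nb (a + 1) a c.
- split; last by nb a b (n - 1).
    have [h|h] : a = n - 3 \/ a < n - 3 by lia.
      by nb b (n - 1) c.
    by nb b (b + 1) c.
  have [h|h] : a = 1 \/ 1 < a by lia.
    by nb a (1 - n) c.
  by nb (a - 1) a c.
- by exfalso; lia.
- split; last by nb a b (n - 1).
    have [h|h] : b = 2 - n \/ 2 - n < b by lia.
      by nb b (1 - n) c.
    by nb b (b - 1) c.
  have [h|h] : a = -1 \/ a < -1 by lia.
    by nb a (n - 1) c.
  by nb (a + 1) a c.
- split; [nb (n - 2) b c | nb a (-2 : int) c | nb a (-2 : int) b].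
- split; [nb (-1 : int) b c | nb (n - 3) a c | nb (n - 3) a b].
- split; [nb (2 - n) b c | nb a 2%:Z c | nb a b (- n)].
- split; [nb (2 - n) b c | nb a (2 - n) c | nb a b n].
- split; [nb 1%:Z b c | nb (3 - n) a c | nb a b (- n)].
- split; [nb 1%:Z b c | nb 1%:Z a c | nb a b n].
by split; [nb b (1 - n) c | nb a (1 - n) c | nb a b (n - 1)].
Qed.

(** * Complexes given by a predicate for their facets *)

Implicit Types (A G H : face) (K L : complex) (P Q : face -> Prop).

(** With a predicate for the generating faces, operations on complexes become logical operations. If
    these faces have equal cardinality, they are exactly the facets ([facets_spanned]). *)
Definition spanned K P := forall A, A \in K <-> exists2 G, P G & A `<=` G.
Definition uniform k P := forall G, P G -> #|` G| = k.

Lemma spanned_generated s : spanned (generated s) (fun G => G \in s).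
Proof.
move=> A; split=> [/bigfcupP[G /andP[Gs _]]|[G Gs sAG]].
  by rewrite fpowersetE => sAG; exists G.
by apply/bigfcupP; exists G; rewrite ?Gs // fpowersetE.
Qed.

Lemma spanned_simplex A : spanned (simplex A) (eq A).
Proof.
move=> C; rewrite fpowersetE; split=> [sCA|[_ <-] //].
by exists A.
Qed.

Lemma eq_spanned K P Q : (forall G, P G <-> Q G) -> spanned K P -> spanned K Q.
Proof.
move=> ePQ spK A; rewrite spK.
by split=> -[G /ePQ PG sAG]; exists G.
Qed.

Lemma spannedU K L P Q : spanned K P -> spanned L Q ->
  spanned (K `|` L) (fun G => P G \/ Q G).
Proof.
move=> spK spL A; rewrite in_fsetU; split.
  by case/orP=> [/spK|/spL] [G PG sAG]; exists G => //; [left | right].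
by case=> G [PG|QG] sAG; apply/orP; [left; apply/spK | right; apply/spL]; exists G.
Qed.

Lemma spanned_cone K P v : spanned K P ->
  spanned (cone K v) (fun G => exists2 H, P H & G = v |` H).
Proof.
move=> spK A; split=> [/imfset2P[X XK [Y]]|].
  rewrite /= fpowersetE fsubset1 => vY ->.
  have [H PH sXH] := (spK X).1 XK.
  exists (v |` H); first by exists H.
  rewrite fsubUset (fsubset_trans sXH (fsubsetUr _ _)) /=.
  by case/orP: vY => /eqP->; rewrite ?fsubsetUl ?fsub0set.
case=> _ [H PH ->] sA; apply/imfset2P.
exists (A `&` H); first by apply/spK; exists H; rewrite ?fsubsetIr.
exists (A `&` [fset v]); first by rewrite /= fpowersetE fsubsetIr.
rewrite -fsetIUr; apply/esym/fsetIidPl; by rewrite fsetUC.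
Qed.

Lemma in_neg_face A (v : int) : (v \in neg_face A) = (- v \in A).
Proof.
apply/imfsetP/idP => [[w wA ->]|vA]; first by rewrite opprK.
by exists (- v); rewrite ?opprK.
Qed.

Lemma neg_faceK : involutive neg_face.
Proof. by move=> A; apply/fsetP=> v; rewrite !in_neg_face opprK. Qed.

Lemma neg_faceS A G : (neg_face A `<=` neg_face G) = (A `<=` G).
Proof.
by apply/fsubsetP/fsubsetP => sAG v; move: (sAG (- v));
  rewrite !in_neg_face ?opprK.
Qed.

Lemma card_neg_face A : #|` neg_face A| = #|` A|.
Proof. by rewrite card_imfset //; apply: oppr_inj. Qed.

Lemma spanned_neg K P : spanned K P ->
  spanned (neg_complex K) (fun G => P (neg_face G)).
Proof.
move=> spK A; split=> [/imfsetP[X /= /spK[G PG sXG] ->]|[G PG sAG]].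
  by exists (neg_face G); rewrite ?neg_faceK ?neg_faceS.
apply/imfsetP; exists (neg_face A); rewrite /= ?neg_faceK //.
by apply/spK; exists (neg_face G); rewrite ?neg_faceS.
Qed.

Section Uniform.
Variables (k : nat) (K : complex) (P : face -> Prop).
Hypotheses (spK : spanned K P) (cardP : uniform k P).

Lemma spanned_uniform_inj G H : P G -> P H -> G `<=` H -> G = H.
Proof.
by move=> PG PH sGH; apply/eqP; rewrite eqEfcard sGH !cardP /=.
Qed.

Lemma facets_spanned G : G \in facets K <-> P G.
Proof.
split=> [|PG].
  rewrite !inE /= => /andP[/spK[H PH sGH] /forallP maxG].
  have HK : H \in K by apply/spK; exists H.
  have /implyP/(_ sGH) := maxG [` HK].
  by move=> /eqP <-.
have GK : G \in K by apply/spK; exists G.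
rewrite !inE GK; apply/forallP=> X; apply/implyP => /= sGX.
have [H PH sXH] := (spK (val X)).1 (valP X).
have eGH := spanned_uniform_inj PG PH (fsubset_trans sGX sXH).
by rewrite eqEfsubset sGX eGH sXH.
Qed.

Lemma spanned_pure : (exists G, P G) -> pure k K.
Proof.
case=> G PG; split; last by move=> A /facets_spanned/cardP.
by apply/fset0Pn; exists G; apply/spK; exists G.
Qed.

Lemma spanned_diffc L : spanned (diffc K L) (fun G => P G /\ G \notin L).
Proof.
apply: eq_spanned (spanned_generated _) => G.
rewrite mem_filter; split=> [/andP[-> /facets_spanned]|[PG ->]] //.
by apply/facets_spanned.
Qed.

Lemma uniform_mem L Q : spanned L Q -> uniform k Q -> forall G, P G ->
  G \in L <-> Q G.
Proof.
move=> spL cQ G PG; split=> [/spL[H QH sGH]|QG]; last by apply/spL; exists G.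
suff -> : G = H by [].
by apply/eqP; rewrite eqEfcard sGH (cardP PG) (cQ _ QH) /=.
Qed.

Lemma spanned_boundary : spanned (boundary K) (fun A =>
  exists G, [/\ P G, A `<=` G, k = #|` A|.+1 &
    forall H, P H -> A `<=` H -> H = G]).
Proof.
apply: eq_spanned (spanned_generated _) => A.
pose S := [fset G in facets K | (A `<=` G) && (#|` G| == #|` A|.+1)].
have memS H : H \in S <-> [/\ P H, A `<=` H & #|` H| = #|` A|.+1].
  rewrite /S; split=> [|[/facets_spanned HK sAH /eqP cA]].
    by rewrite inE /= inE => /and3P[/facets_spanned HK sAH /eqP cA].
  by rewrite inE /= inE HK sAH.
rewrite mem_filter -/S; split=> [/andP[/cardfs1P[G eG] _]|[G [PG sAG cA uG]]].
  have /memS[PG sAG cA] : G \in S by rewrite eG inE.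
  exists G; split; rewrite -?cA ?cardP // => H PH sAH.
  by apply/fset1P; rewrite -eG; apply/memS; rewrite -cA !cardP.
have -> : A \in K by apply/spK; exists G.
rewrite andbT; apply/cardfs1P; exists G.
apply/fsetP=> H; rewrite in_fset1; apply/idP/eqP => [/memS[PH sAH _]|->].
  exact: uG.
by apply/memS; rewrite cardP.
Qed.

End Uniform.

(** * Restriction faces and symmetric shellings *)

(** A face of [G] lying in some [H] of [s] misses a vertex of [R], because [H] does not contain [R].
    So the intersection is generated by the ridges opposite to the vertices of [R]. *)
Lemma pure_intersection d G R s : #|` G| = d.+1 -> R `<=` G -> (0 < size s)%N ->
    (forall H, H \in s -> ~~ (R `<=` H)) ->
    (forall v, v \in R -> exists2 H, H \in s & G `\ v `<=` H) ->
  pure d (simplex G `&` generated s).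
Proof.
move=> cG sRG s_gt0 nRs Rs.
have sp : spanned (simplex G `&` generated s)
    (fun C => exists2 v, v \in R & C = G `\ v).
  move=> A; rewrite in_fsetI fpowersetE; split.
    case/andP=> sAG /spanned_generated[H Hs sAH].
    have /fsubsetPn[v vR vH] := nRs H Hs.
    exists (G `\ v); first by exists v.
    by rewrite fsubsetD1 sAG; apply: contra vH; apply: (fsubsetP sAH).
  case=> _ [v vR ->] sAG; rewrite (fsubset_trans sAG) ?fsubD1set //.
  apply/spanned_generated; have [H Hs sGH] := Rs v vR.
  by exists H => //; apply: fsubset_trans sGH.
apply: spanned_pure sp _ _.
  by move=> _ [v vR ->]; have := cardfsD1 v G; rewrite (fsubsetP sRG) // cG => -[].
(* [R] is nonempty, not being contained in the first face of [s]. *)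
case: s s_gt0 nRs {Rs} => // H s _ /(_ H (mem_head _ _)) /fsubsetPn[v vR _].
by exists (G `\ v), v.
Qed.

Lemma mem_takeP (T : eqType) (x0 x : T) s t :
  reflect (exists2 u, (u < minn t (size s))%N & nth x0 s u = x) (x \in take t s).
Proof.
apply: (iffP (nthP x0)) => -[u]; rewrite size_take_min => lu <-; exists u => //.
  by rewrite nth_take //; move: lu; rewrite leq_min => /andP[].
by rewrite nth_take //; move: lu; rewrite leq_min => /andP[].
Qed.

Lemma mem_dropP (T : eqType) (x0 x : T) s t :
  reflect (exists2 u, (t <= u < size s)%N & nth x0 s u = x) (x \in drop t s).
Proof.
apply: (iffP (nthP x0)) => -[u]; rewrite ?size_drop => lu <-.
  by exists (t + u)%N; [lia | rewrite nth_drop].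
by exists (u - t)%N; [lia | rewrite nth_drop subnKC //; lia].
Qed.

(* In a complex where every ridge lies in a second facet, the ridge opposite to
   a vertex of [R] can only be shared with an earlier facet, as all the later
   ones miss [G `\` R]; symmetrically for the vertices of [G `\` R], which is the
   restriction set of [- G] in the second half. *)
Lemma symmetric_shelling d K P (F : seq face) : spanned K P -> uniform d.+1 P ->
    (forall G, P G <-> G \in F \/ neg_face G \in F) ->
    (forall G v, P G -> v \in G ->
      exists H, [/\ P H, v \notin H & G `\ v `<=` H]) ->
    (forall t, (t < size F)%N -> let G := nth fset0 F t in
      exists R, [/\ R `<=` G,
        forall u, (u < t)%N -> ~~ (R `<=` nth fset0 F u),
        forall u, (t < u < size F)%N -> ~~ (G `\` R `<=` nth fset0 F u) &
        forall u, (u < size F)%N ->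
          ~~ (G `\` R `<=` neg_face (nth fset0 F u))]) ->
    (0 < size F)%N ->
  shelling_order d K (F ++ rev [seq neg_face A | A <- F]).
Proof.
move=> spK cP memF ridge step F_gt0.
have nthF u : (u < size F)%N -> P (nth fset0 F u).
  by move=> lu; apply/memF; left; apply: mem_nth.
have P_neg G : P G <-> P (neg_face G).
  by rewrite !memF neg_faceK; tauto.
have size_mF : size [seq neg_face A | A <- F] = size F by rewrite size_map.
split.
- by apply: spanned_pure spK cP _; exists (nth fset0 F 0); apply: nthF.
- apply: uniq_perm; [|exact: fset_uniq|move=> G].
    rewrite cat_uniq rev_uniq (map_inj_uniq (can_inj neg_faceK)).
    (* An earlier copy of [G] in [F] would contain [R]. *)
    have -> : uniq F.
      apply/(uniqP fset0) => t u; rewrite !inE.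
      wlog ltut : t u / (u < t)%N => [hw|] lt lu eF.
        case: (ltngtP u t) => // h; first exact: hw.
        by apply/esym; apply: hw.
      have [R [sRG nR _ _]] := step t lt.
      by have := nR u ltut; rewrite -eF sRG.
    (* If [G] in [F] were the antipode of a face of [F], that antipode would contain [G \ R]. *)
    rewrite andbT /=; apply/hasPn => G; rewrite mem_rev => /mapP[H HF ->].
    apply/negP => /(nthP fset0)[t lt eH]; have [u lu eu] := (nthP fset0 HF).
    have [R [_ _ _ /(_ u lu)]] := step t lt.
    by rewrite eH eu fsubsetDl.
  rewrite mem_cat mem_rev; apply/idP/idP.
    move=> h; apply/(facets_spanned spK cP)/memF.
    by case/orP: h => [|/mapP[H HF ->]]; [left | right; rewrite neg_faceK].
  move=> /(facets_spanned spK cP)/memF[->//|h].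
  by apply/orP; right; apply/mapP; exists (neg_face G); rewrite ?neg_faceK.
move=> t; rewrite size_cat size_rev size_mF nth_cat take_cat => /andP[t_gt0 lt].
case: ltnP => [ltF|leF].
  have [R [sRG nR nRu nRo]] := step t ltF.
  apply: (pure_intersection _ sRG); first by rewrite cP //; apply: nthF.
  - by rewrite size_take ltF.
  - by move=> H /(mem_takeP fset0)[u lu <-]; apply: nR; lia.
  move=> v vR; have vG := fsubsetP sRG v vR.
  have [H [PH vH sGH]] := ridge _ _ (nthF t ltF) vG.
  (* As [v] is in [R], the neighbour [H] contains [G \ R]. Later facets of [F] and antipodes do not,
     so [H] is earlier. *)
  have sDH : nth fset0 F t `\` R `<=` H.
    by apply: fsubset_trans sGH; apply: fsetDS; rewrite fsub1set.
  exists H => //; case/memF: PH => [/(nthP fset0)[u lu eu]|/(nthP fset0)[u lu eu]].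
    apply/(mem_takeP fset0); exists u => //; rewrite leq_min lu andbT.
    rewrite ltnNge; apply/negP; rewrite leq_eqVlt => /orP[/eqP etu|ltu].
      by rewrite -eu -etu vG in vH.
    by have /negP[] := nRu u (introT andP (conj ltu lu)); rewrite eu.
  by have /negP[] := nRo u lu; rewrite eu neg_faceK.
(* Position [t] of the whole order holds the antipode of the facet of index [c] in [F]; it is
   preceded by [F] and by the antipodes of the facets of index above [c]. *)
set c := (size F - (t - size F).+1)%N.
have ltc : (c < size F)%N by rewrite /c; lia.
have -> : nth fset0 (rev [seq neg_face A | A <- F]) (t - size F) =
    neg_face (nth fset0 F c).
  rewrite nth_rev size_mF; last by rewrite ltn_subLR.
  by rewrite (nth_map fset0).
have -> : take (t - size F) (rev [seq neg_face A | A <- F]) =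
    rev [seq neg_face A | A <- drop c.+1 F].
  rewrite take_rev size_mF -map_drop; congr (rev (map _ (drop _ _))).
  by rewrite /c; lia.
set s2 := rev _.
have mem_s2 u : (c < u < size F)%N -> neg_face (nth fset0 F u) \in s2.
  move=> hu; rewrite mem_rev map_f //; apply/(mem_dropP fset0); by exists u.
have [R [sRG nR nRu nRo]] := step c ltc; set G := nth fset0 F c in sRG nRu nRo *.
apply: (@pure_intersection _ _ (neg_face (G `\` R))).
- by rewrite card_neg_face cP //; apply: nthF.
- by rewrite neg_faceS fsubsetDl.
- by rewrite size_cat addn_gt0 F_gt0.
- move=> H; rewrite mem_cat -neg_faceS neg_faceK.
  case/orP=> [/(nthP fset0)[u lu <-]|]; first exact: nRo.
  rewrite mem_rev => /mapP[_ /(mem_dropP fset0)[u hu <-] ->].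
  by rewrite neg_faceK nRu.
move=> v; rewrite in_neg_face => vD.
have [vG vR] : - v \in G /\ - v \notin R by move: vD; rewrite in_fsetD => /andP[].
have [] := ridge _ v ((P_neg _).1 (nthF c ltc)); first by rewrite in_neg_face.
move=> H [PH vH sGH]; exists H => //; rewrite mem_cat.
(* If the antipode of [H] is in [F], its index exceeds [c]: equality would put [v] in [H], and a
   smaller index would give an earlier facet containing [R]. *)
case/memF: PH => [-> //|/(nthP fset0)[u lu eu]]; apply/orP; right.
rewrite -[H]neg_faceK -eu; apply: mem_s2; rewrite lu andbT ltnNge.
apply/negP; rewrite leq_eqVlt => /orP[/eqP euc|ltuc].
  by move: vH; rewrite -[H]neg_faceK -eu euc in_neg_face vG.
have /negP[] := nR u ltuc; rewrite eu -neg_faceS neg_faceK.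
apply: fsubset_trans sGH; rewrite fsubsetD1 neg_faceS sRG in_neg_face.
exact: vR.
Qed.

(** * Facets of the path, of the cross-polytope and of [B 3 1 n] *)

Variant tetra (S : int -> int -> int -> int -> Prop) G : Prop :=
  Tetra p q r s of S p q r s & G = [fset p; q; r; s].

Variant triangle (S : int -> int -> int -> Prop) G : Prop :=
  Triangle p q r of S p q r & G = [fset p; q; r].

Lemma spanned_path s : spanned (path_complex s) (fun G =>
  exists2 i, (i.+1 < size s)%N & G = [fset nth 0 s i; nth 0 s i.+1]).
Proof.
have size_pairs : size (zip s (behead s)) = (size s).-1.
  by rewrite size_zip size_behead; apply/minn_idPr/leq_pred.
have nth_pairs i : (i.+1 < size s)%N ->
    nth (0, 0) (zip s (behead s)) i = (nth 0 s i, nth 0 s i.+1).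
  by move=> lti; rewrite nth_zip_cond size_pairs ltn_predRL lti nth_behead.
apply: eq_spanned (spanned_generated _) => G; split.
  case/mapP=> e /(nthP (0, 0))[i]; rewrite size_pairs ltn_predRL => lti <- ->.
  by exists i; rewrite ?nth_pairs.
case=> i lti ->; apply/mapP; exists (nth 0 s i, nth 0 s i.+1) => //.
by rewrite -nth_pairs // mem_nth // size_pairs ltn_predRL.
Qed.

Lemma spanned_path_ball m : (2 <= m)%N ->
  spanned (diffc (Delta1 m) (B10 m))
    (fun G => exists p q, edge m p q /\ G = [fset p; q]).
Proof.
move=> hm; set s := poss m ++ negs m ++ [:: 1].
have size_s : size s = (m + m).+1.
  by rewrite !size_cat !size_map size_iota addnA addn1.
have nth_s i : (i <= m + m)%N -> nth 0 s i = if (i < m)%N then i.+1%:Z else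
    if (i < m + m)%N then m%:Z - i.+1%:Z else 1.
  move=> hi; rewrite !nth_cat !size_map !size_iota; case: ltnP => h1.
    by rewrite (nth_map 0%N) ?size_iota // nth_iota.
  rewrite ltn_subLR //; case: ltnP => h2.
    by rewrite (nth_map 0%N) ?nth_iota ?size_iota ?ltn_subLR //; lia.
  by have -> : (i - m - m = 0)%N by lia.
have sp : spanned (Delta1 m)
    (fun G => exists p q, (edge m p q \/ p = m /\ q = -1) /\ G = [fset p; q]).
  apply: eq_spanned (spanned_path s) => G; rewrite size_s; split.
    case=> i lti ->; rewrite !nth_s; [|lia|lia].
    have [lim|lim] := ltnP i m.
      exists i.+1%:Z; have [lim1|lim1] := ltnP i.+1 m.
        by exists i.+2%:Z; split=> //; left; constructor 1; lia.
      have -> : (i.+1 < m + m)%N by lia.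
      by exists (m%:Z - i.+2%:Z); split=> //; right; lia.
    have -> : (i < m + m)%N by lia.
    have -> : (i.+1 < m)%N = false by lia.
    have [lim1|lim1] := ltnP i.+1 (m + m).
      exists (m%:Z - i.+1%:Z), (m%:Z - i.+2%:Z); split=> //.
      by left; constructor 3; lia.
    exists 1, (m%:Z - i.+1%:Z); split; last by rewrite fsetUC.
    by left; constructor 2; lia.
  (* The cycle traverses its last edge from [- m] to [1], whereas edges are listed by absolute
     value; hence the swap at [i.+1 = m + m]. *)
  case=> p [q [e ->]]; have [i [hi ep eq]] : exists i, [/\ (i.+1 < (m + m).+1)%N,
      p = (if i.+1 == (m + m)%N then nth 0 s i.+1 else nth 0 s i) &
      q = (if i.+1 == (m + m)%N then nth 0 s i else nth 0 s i.+1)].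
    case: e => [[hp hq|hp hq|hp hq]|[hp hq]].
    - by exists `|p|%N.-1; rewrite !nth_s; [split; (do ?case: ifP => ?); lia|lia|lia].
    - by exists (m + m).-1; rewrite !nth_s; [split; (do ?case: ifP => ?); lia|lia|lia].
    - by exists (m + `|p|).-1; rewrite !nth_s; [split; (do ?case: ifP => ?); lia|lia|lia].
    by exists m.-1; rewrite !nth_s; [split; (do ?case: ifP => ?); lia|lia|lia].
  exists i => //; rewrite ep eq; case: ifP => // _; exact: fsetUC.
have card2 : uniform 2 (fun G => exists p q,
    (edge m p q \/ p = m /\ q = -1) /\ G = [fset p; q]).
  move=> _ [p [q [e ->]]]; rewrite cardfs2.
  by have -> : p != q by case: e => [[]|[]]; lia.
apply: eq_spanned (spanned_diffc sp card2 _) => G; split.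
  case=> -[p [q [[e|[-> ->]] ->]]] nB; first by exists p, q.
  by move: nB; rewrite /B10 fpowersetE fsetUC fsubset_refl.
case=> p [q [e ->]]; split; first by exists p, q; split; first by left.
by rewrite /B10 fpowersetE fsubUset !fsub1set !inE; case: e; lia.
Qed.

Lemma spanned_cross4 : spanned (cross_boundary 4) (tetra (sphere 4)).
Proof.
have inV v : (v \in V 4) = (0 < `|v| <= 4).
  by rewrite !inE /=; lia.
move=> A; rewrite /cross_boundary; split.
  rewrite !inE /= fpowersetE => /andP[/fsubsetP sAV /forallP noA].
  have noA' v : v \in A -> - v \notin A by move=> vA; have := noA [` vA].
  (* A facet above [A] takes, for each [k], the vertex [k] if it is in [A] and [- k] otherwise; [A]
     never contains both. *)
  have pick k : exists2 v : int, `|v| = k%:Z &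
      forall w, w \in A -> `|w| = k%:Z -> w = v.
    have [kA|kA] := boolP (k%:Z \in A).
      exists k%:Z => [|w wA hw]; first by lia.
      have [//|ew] : w = k%:Z \/ - w = k%:Z by lia.
      by have := noA' _ wA; rewrite ew kA.
    exists (- k%:Z) => [|w wA hw]; first by lia.
    have [ew|//] : w = k%:Z \/ w = - k%:Z by lia.
    by rewrite -ew wA in kA.
  have [p hp up] := pick 1%N.
  have [q hq uq] := pick 2%N.
  have [r hr ur] := pick 3%N.
  have [s hs us] := pick 4%N.
  exists [fset p; q; r; s]; first by exists p q r s => //; apply: sphere4.
  apply/fsubsetP=> v vA; have := sAV v vA; rewrite inV !inE => hv.
  have [/(up _ vA)->|[/(uq _ vA)->|[/(ur _ vA)->|/(us _ vA)->]]] : `|v| = 1%:Z \/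
    `|v| = 2%:Z \/ `|v| = 3%:Z \/ `|v| = 4%:Z by lia.
  - by rewrite eqxx.
  - by rewrite eqxx orbT.
  - by rewrite eqxx orbT.
  by rewrite eqxx orbT.
case=> _ [p q r s /sphere_sorted h ->] /fsubsetP sA; have {h} [h0 h1 h2] := h isT.
have sA' v : v \in A -> [|| v == p, v == q, v == r | v == s].
  by move=> /sA; rewrite !inE -!orbA.
rewrite !inE /= fpowersetE; apply/andP; split.
  by apply/fsubsetP=> v /sA'; rewrite inV; lia.
apply/forallP=> -[v vA] /=; apply/negP=> /sA'; have := sA' _ vA.
by lia.
Qed.

Lemma spanned_B31 n : (4 <= n)%N -> spanned (B 3 1 n) (tetra (ball n)).
Proof.
case: n => [|[|n]] // hn.
(* Now [n] is two less than in the statement: it indexes the path, and the two coning steps use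
   [n.+1] and [n.+2]. *)
have sp10 : spanned (B 1 0 n) (eq [fset -1; n%:Z]) by apply: spanned_simplex.
have sp11 : spanned (B 1 1 n) (fun G => exists p q, edge n p q /\ G = [fset p; q]).
  by apply: spanned_path_ball.
have sp20 : spanned (B 2 0 n.+1) (eq [fset -1; n%:Z; n.+1%:Z]).
  rewrite B_joinE // fsetU0.
  apply: eq_spanned (spanned_cone _ sp10) => G; split=> [[_ <- ->]|<-].
    by apply/fsetP=> v; rewrite !inE; lia.
  by exists [fset -1; n%:Z] => //; apply/fsetP=> v; rewrite !inE; lia.
have sp21 := spannedU (spanned_cone n.+1%:Z sp11)
                      (spanned_cone (- n.+1%:Z) (spanned_neg sp10)).
have := spannedU (spanned_cone n.+2%:Z sp21)
                 (spanned_cone (- n.+2%:Z) (spanned_neg sp20)).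
apply: eq_spanned => G; split.
  case=> [[_ [[_ [p [q [e ->]] ->]]|[H eH ->]] ->]|[H eH ->]].
  - exists p q n.+1%:Z n.+2%:Z.
      by constructor 1; [have -> : n.+2%:Z - 2 = n by lia| lia|].
    by apply/fsetP=> v; rewrite !inE; lia.
  - exists 1 (- n%:Z) (- n.+1%:Z) n.+2%:Z; first by constructor 2; lia.
    by apply/fsetP=> v; rewrite -[H]neg_faceK -eH !inE in_neg_face !inE; lia.
  - exists 1 (- n%:Z) (- n.+1%:Z) (- n.+2%:Z); first by constructor 3; lia.
    by apply/fsetP=> v; rewrite -[H]neg_faceK -eH !inE in_neg_face !inE; lia.
case=> p q r s h ->; case: h => [e hr hs|hp hq hr hs|hp hq hr hs].
- left; exists (n.+1%:Z |` [fset p; q]).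
    left; exists [fset p; q] => //; exists p, q; split=> //.
    by have <- : n.+2%:Z - 2 = n by lia.
  by apply/fsetP=> v; rewrite !inE; lia.
- left; exists (- n.+1%:Z |` neg_face [fset -1; n%:Z]).
    by right; exists (neg_face [fset -1; n%:Z]); rewrite ?neg_faceK.
  by apply/fsetP=> v; rewrite !inE in_neg_face !inE; lia.
right; exists (neg_face [fset -1; n%:Z; n.+1%:Z]); rewrite ?neg_faceK //.
by apply/fsetP=> v; rewrite !inE in_neg_face !inE; lia.
Qed.

(** * Passing between vertex lists and faces *)

Lemma sub_fset4 (a b c p q r s : int) :
  ([fset a; b; c] `<=` [fset p; q; r; s]) = all (mem [:: p; q; r; s]) [:: a; b; c].
Proof. by rewrite !fsubUset !fsub1set !inE /= !inE andbT -!andbA -!orbA. Qed.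

Lemma neg_fset4 (p q r s : int) :
  neg_face [fset p; q; r; s] = [fset - p; - q; - r; - s].
Proof. by apply/fsetP=> v; rewrite in_neg_face !inE; lia. Qed.

Lemma neg_fset3 (p q r : int) : neg_face [fset p; q; r] = [fset - p; - q; - r].
Proof. by apply/fsetP=> v; rewrite in_neg_face !inE; lia. Qed.

Lemma fset4_inj (p q r s p' q' r' s' : int) :
    (`|p| < `|q|) && (`|q| < `|r| < `|s|) ->
    (`|p'| < `|q'|) && (`|q'| < `|r'| < `|s'|) ->
    [fset p; q; r; s] = [fset p'; q'; r'; s'] ->
  [/\ p = p', q = q', r = r' & s = s'].
Proof.
move=> h h' e.
have sub1 : [fset p; q; r] `<=` [fset p'; q'; r'; s'] by rewrite -e fsubsetUl.
have sub2 : [fset q; r; s] `<=` [fset p'; q'; r'; s'].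
  by rewrite -e; apply/fsubsetP=> v; rewrite !inE; lia.
rewrite !sub_fset4 in sub1 sub2.
have h1 : `|p| < `|q| < `|r| by lia.
have h2 : `|q| < `|r| < `|s| by lia.
case: (sorted_sub h1 h' sub1) => -[e1 e2 e3];
case: (sorted_sub h2 h' sub2) => -[e4 e5 e6]; split; lia.
Qed.

Section Faces.
Variable n : int.
Hypothesis n4 : 4 <= n.

Lemma uniform_sphere : uniform 4 (tetra (sphere n)).
Proof.
move=> _ [p q r s /(sphere_sorted n4)[_ h _] ->].
rewrite fsetUC cardfsU1 fsetUC cardfsU1 fsetUC cardfsU1 cardfs1 !inE; lia.
Qed.

Lemma uniform_ball : uniform 4 (tetra (ball n)).
Proof.
move=> G [p q r s h eG]; apply: uniform_sphere; exists p q r s => //.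
by left; left.
Qed.

Lemma card_bd A : triangle (ball_bd n) A -> #|` A| = 3%N.
Proof.
move=> [p q r /(bd_sorted n4) h ->].
rewrite fsetUC cardfsU1 fsetUC cardfsU1 cardfs1 !inE; lia.
Qed.

Lemma sphere_bound G v : tetra (sphere n) G -> v \in G -> `|v| <= n.
Proof.
by move=> [p q r s /(sphere_sorted n4)[h1 h2 h3] ->]; rewrite !inE; lia.
Qed.

Lemma tetra_sphere_neg G : tetra (sphere n) G -> tetra (sphere n) (neg_face G).
Proof.
case=> p q r s h ->; exists (- p) (- q) (- r) (- s); first exact: sphere_opp.
exact: neg_fset4.
Qed.

Lemma ball_sphere G : tetra (ball n) G -> tetra (sphere n) G.
Proof. by case=> p q r s h ->; exists p q r s => //; left; left. Qed.

Lemma ball_ridge G v : tetra (ball n) G -> v \in G ->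
  triangle (ball_bd n) (G `\ v) \/
  forall H, tetra (sphere n) H -> G `\ v `<=` H -> tetra (ball n) H.
Proof.
case=> p q r s h ->; have hs := ball_sorted n4 h.
have [spec_p spec_q spec_r spec_s] := ball_ridges n4 h.
have main a b c : ridge_spec n (ball_bd n a b c) [:: a; b; c] ->
    [fset p; q; r; s] `\ v = [fset a; b; c] ->
    triangle (ball_bd n) ([fset p; q; r; s] `\ v) \/
    forall H, tetra (sphere n) H -> [fset p; q; r; s] `\ v `<=` H ->
      tetra (ball n) H.
  case=> [bd|int_abc] ->; [left; by exists a b c | right=> H].
  case=> p' q' r' s' h' ->; rewrite sub_fset4 => sub.
  by exists p' q' r' s' => //; apply: int_abc.
rewrite !inE -!orbA => /or4P[] /eqP ev.
- by apply: main spec_p _; apply/fsetP=> w; rewrite !inE; lia.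
- by apply: main spec_q _; apply/fsetP=> w; rewrite !inE; lia.
- by apply: main spec_r _; apply/fsetP=> w; rewrite !inE; lia.
by apply: main spec_s _; apply/fsetP=> w; rewrite !inE; lia.
Qed.

Lemma bd_facet A : triangle (ball_bd n) A -> exists G,
  [/\ tetra (ball n) G, A `<=` G & forall H, tetra (ball n) H -> A `<=` H -> H = G].
Proof.
case=> a b c bd ->; have [p [q [r [s [h sub uq]]]]] := bd_ball n4 bd.
exists [fset p; q; r; s]; split; first by exists p q r s.
  by rewrite sub_fset4.
move=> _ [p' q' r' s' h' ->]; rewrite sub_fset4 => sub'.
by have [-> -> -> ->] := uq _ _ _ _ h' sub'.
Qed.

Lemma bd_closed A v : triangle (ball_bd n) A -> v \in A ->
  exists A', [/\ triangle (ball_bd n) A', v \notin A' & A `\ v `<=` A'].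
Proof.
case=> a b c bd ->; have hs := bd_sorted n4 bd.
have [nb_a nb_b nb_c] := bd_neighbours n4 bd.
have main x y z : bd_nb n x [:: y; z] -> [fset a; b; c] `\ x = [fset y; z] ->
    exists A', [/\ triangle (ball_bd n) A', x \notin A' & [fset a; b; c] `\ x `<=` A'].
  case=> a' [b' [c' [bd' sub nv]]] ->; exists [fset a'; b'; c'].
  split; first by exists a' b' c'.
    by move: nv; rewrite !inE -orbA.
  by move: sub; rewrite /= !fsubUset !fsub1set !inE -!orbA andbT.
rewrite !inE -!orbA => /or3P[] /eqP->.
- by apply: main nb_a _; apply/fsetP=> w; rewrite !inE; lia.
- by apply: main nb_b _; apply/fsetP=> w; rewrite !inE; lia.
by apply: main nb_c _; apply/fsetP=> w; rewrite !inE; lia.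
Qed.

End Faces.

(** * From [n] to [n + 1]: second facets on ridges *)

Lemma neg_faceD1 G v : neg_face (G `\ v) = neg_face G `\ - v.
Proof. by apply/fsetP=> w; rewrite in_neg_face !in_fsetD1 in_neg_face eqr_oppLR. Qed.

Lemma neg_faceU1 G v : neg_face (v |` G) = - v |` neg_face G.
Proof. by apply/fsetP=> w; rewrite in_neg_face !in_fset1U in_neg_face eqr_oppLR. Qed.

(** The facets of [Delta 3 n] which are kept in [Delta 3 (n + 1)]. *)
Definition core n p q r s := rest n p q r s \/ rest n (- p) (- q) (- r) (- s).

Lemma core_sphere n p q r s : core n p q r s -> sphere n p q r s.
Proof. by case=> h; [left; right | right; right]. Qed.

Lemma sphere_cases n p q r s : sphere n p q r s ->
  [\/ ball n p q r s, ball n (- p) (- q) (- r) (- s) | core n p q r s].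
Proof.
by case=> -[h|h]; [constructor 1 | constructor 3; left | constructor 2
  | constructor 3; right].
Qed.

Lemma rest_not_ball n p q r s : 4 <= n -> rest n p q r s ->
  ~ ball n p q r s /\ ~ ball n (- p) (- q) (- r) (- s).
Proof. by move=> hn h; split=> h'; split_hyps; lia. Qed.

Lemma core_not_ball n p q r s : 4 <= n -> core n p q r s ->
  ~ ball n p q r s /\ ~ ball n (- p) (- q) (- r) (- s).
Proof.
move=> hn [/(rest_not_ball hn)//|/(rest_not_ball hn)].
by rewrite !opprK; tauto.
Qed.

Lemma tetra_neg (S : int -> int -> int -> int -> Prop) G : tetra S (neg_face G) <->
  tetra (fun p q r s => S (- p) (- q) (- r) (- s)) G.
Proof.
split=> -[p q r s h].
  move/(congr1 neg_face); rewrite neg_faceK neg_fset4 => ->.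
  by exists (- p) (- q) (- r) (- s) => //; rewrite !opprK.
by move=> ->; exists (- p) (- q) (- r) (- s); rewrite ?neg_fset4.
Qed.

Lemma triangle_neg (S : int -> int -> int -> Prop) A : triangle S (neg_face A) <->
  triangle (fun p q r => S (- p) (- q) (- r)) A.
Proof.
split=> -[p q r h].
  move/(congr1 neg_face); rewrite neg_faceK neg_fset3 => ->.
  by exists (- p) (- q) (- r) => //; rewrite !opprK.
by move=> ->; exists (- p) (- q) (- r); rewrite ?neg_fset3.
Qed.

(** The shape matches [replace_balls], with [ball_bd] in place of the boundary. *)
Lemma tetra_sphere_succ n G : 4 <= n -> tetra (sphere (n + 1)) G <->
  [\/ tetra (core n) G,
      exists2 A, triangle (ball_bd n) A & G = (n + 1) |` A |
      exists2 A, triangle (ball_bd n) (neg_face A) & G = - (n + 1) |` A].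
Proof.
move=> hn; split.
  case=> p q r s h ->.
  have {h} : [\/ core n p q r s, s = n + 1 /\ ball_bd n p q r |
      s = - (n + 1) /\ ball_bd n (- p) (- q) (- r)].
    case: h => /(hemisphere_succ hn)[h|h|h].
    - by constructor 1; left.
    - by constructor 2.
    - by constructor 3.
    - by constructor 1; right.
    - by constructor 3; case: h => hs hb; split=> //; lia.
    constructor 2; move: h; rewrite !opprK => -[hs hb]; split=> //; lia.
  case=> [h|[-> h]|[-> h]].
  - by constructor 1; exists p q r s.
  - constructor 2; exists [fset p; q; r]; first by exists p q r.
    exact: fsetUC.
  constructor 3; exists [fset p; q; r]; last exact: fsetUC.
  by apply/triangle_neg; exists p q r.
case=> [[p q r s h ->]|[_ [p q r h ->] ->]|[A /triangle_neg[p q r h ->] ->]].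
- exists p q r s => //; case: h => h; first exact: rest_sphere_succ.
  by rewrite -[p]opprK -[q]opprK -[r]opprK -[s]opprK; apply/sphere_opp/rest_sphere_succ.
- exists p q r (n + 1); first exact: cone_sphere_succ.
  exact: fsetUC.
exists p q r (- (n + 1)); last exact: fsetUC.
rewrite -[p]opprK -[q]opprK -[r]opprK; apply/sphere_opp.
exact: cone_sphere_succ.
Qed.

Definition ridge_closed P := forall G v, P G -> v \in G ->
  exists H, [/\ P H, v \notin H & G `\ v `<=` H].

Lemma closed_neg P G : (forall H, P H -> P (neg_face H)) ->
  (forall v, v \in neg_face G -> exists H, [/\ P H, v \notin H & neg_face G `\ v `<=` H]) ->
  forall v, v \in G -> exists H, [/\ P H, v \notin H & G `\ v `<=` H].
Proof.
move=> Pneg hG v vG; have [] := hG (- v); first by rewrite in_neg_face opprK.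
move=> H [PH vH sGH]; exists (neg_face H); split; first exact: Pneg.
  by rewrite in_neg_face.
apply/fsubsetP=> w; rewrite !inE in_neg_face => /andP[wv wG].
by apply: (fsubsetP sGH); rewrite !inE in_neg_face opprK eqr_opp wv.
Qed.

Lemma sphere_tetra n H : tetra (sphere n) H ->
  [\/ tetra (ball n) H, tetra (ball n) (neg_face H) | tetra (core n) H].
Proof.
case=> p q r s /sphere_cases[h|h|h] eH; [constructor 1|constructor 2|constructor 3].
- by exists p q r s.
- by apply/tetra_neg; exists p q r s.
by exists p q r s.
Qed.

Lemma core_tetra n H : tetra (core n) H -> tetra (sphere n) H.
Proof. by case=> p q r s /core_sphere h ->; exists p q r s. Qed.

Lemma core_not_tetra n H : 4 <= n -> tetra (core n) H ->
  ~ tetra (ball n) H /\ ~ tetra (ball n) (neg_face H).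
Proof.
move=> hn [p q r s h ->]; have [nh nh'] := core_not_ball hn h.
have [_ so _] := sphere_sorted hn (core_sphere h).
split=> [|/tetra_neg] [p' q' r' s' h' e].
  have so' := ball_sorted hn h'.
  by have [ep eq er es] := fset4_inj so so' e; subst.
have so' : (`|p'| < `|q'|) && (`|q'| < `|r'| < `|s'|).
  by have := ball_sorted hn h'; rewrite !normrN.
by have [ep eq er es] := fset4_inj so so' e; subst.
Qed.

(** The neighbour of a kept facet is kept, or lies in a removed ball and is replaced by the cone
    over the common ridge. For a cone facet, ridges through the apex come from [bd_closed], and the
    base from crossing it in the old sphere. *)
Lemma ridge_closed_succ n : 4 <= n ->
  ridge_closed (tetra (sphere n)) -> ridge_closed (tetra (sphere (n + 1))).
Proof.
move=> hn cl.
(* By cardinality this is also a ridge of [H]; were it interior to the ball, [G] would be in the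
   ball. *)
have shared G H v : tetra (sphere n) G -> ~ tetra (ball n) G -> tetra (ball n) H ->
    v \in G -> G `\ v `<=` H -> triangle (ball_bd n) (G `\ v).
  move=> SG nBG BH vG sGH.
  have cG : #|` G `\ v| = 3%N.
    by have := cardfsD1 v G; rewrite vG (uniform_sphere hn SG) => -[].
  have /fsubsetPn[w wH wG] : ~~ (H `<=` G `\ v).
    by apply/negP=> /fsubset_leq_card; rewrite cG (uniform_ball hn BH).
  have eGH : G `\ v = H `\ w.
    apply/eqP; rewrite eqEfcard fsubsetD1 sGH wG /=.
    by have := cardfsD1 w H; rewrite wH (uniform_ball hn BH) cG add1n => -[<-].
  rewrite eGH; case: (ball_ridge hn BH wH) => // int_w; case: nBG.
  by apply: int_w SG _; rewrite -eGH fsubD1set.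
have bd_bound A v : triangle (ball_bd n) A -> v \in A -> `|v| <= n.
  case/(bd_facet hn) => H [BH sAH _] vA.
  exact: sphere_bound hn _ _ (ball_sphere BH) (fsubsetP sAH _ vA).
have type1 G v : tetra (core n) G -> v \in G ->
    exists H, [/\ tetra (sphere (n + 1)) H, v \notin H & G `\ v `<=` H].
  move=> CG vG; have SG := core_tetra CG; have [nBG nBG'] := core_not_tetra hn CG.
  have vn := sphere_bound hn SG vG.
  have [H [SH vH sGH]] := cl G v SG vG.
  case: (sphere_tetra SH) => [BH|BH|CH].
  - have bd := shared _ _ _ SG nBG BH vG sGH.
    exists ((n + 1) |` (G `\ v)); rewrite fsubsetUr; split=> //.
      by apply/tetra_sphere_succ=> //; constructor 2; exists (G `\ v).
    by rewrite !inE eqxx /= orbF; lia.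
  - have bd : triangle (ball_bd n) (neg_face (G `\ v)).
      rewrite neg_faceD1; apply: (shared _ (neg_face H)) => //.
      + exact: tetra_sphere_neg.
      + by rewrite in_neg_face opprK.
      by rewrite -neg_faceD1 neg_faceS.
    exists (- (n + 1) |` (G `\ v)); rewrite fsubsetUr; split=> //.
      by apply/tetra_sphere_succ=> //; constructor 3; exists (G `\ v).
    by rewrite !inE eqxx /= orbF; lia.
  by exists H; split=> //; apply/tetra_sphere_succ=> //; constructor 1.
have type2 A v : triangle (ball_bd n) A -> v \in (n + 1) |` A ->
    exists H, [/\ tetra (sphere (n + 1)) H, v \notin H & ((n + 1) |` A) `\ v `<=` H].
  move=> bd; rewrite !inE => /orP[/eqP->|vA]; last first.
    have [A' [bd' vA' sA]] := bd_closed hn bd vA.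
    have vn := bd_bound A v bd vA.
    exists ((n + 1) |` A'); split.
    - by apply/tetra_sphere_succ=> //; constructor 2; exists A'.
    - by rewrite !inE negb_or vA' andbT; lia.
    apply/fsubsetP=> w; rewrite !inE => /andP[wv /orP[->//|wA]].
    by apply/orP; right; apply: (fsubsetP sA); rewrite !inE wv.
  have nA : (n + 1) \notin A.
    by apply/negP=> /(bd_bound A _ bd); lia.
  rewrite fsetU1K //.
  (* The ridge opposite to the apex is [A] itself: start from the ball facet [G] on [A] and cross
     [A] in the old sphere. *)
  have [G [BG sAG uG]] := bd_facet hn bd.
  have SG := ball_sphere BG.
  have cA := card_bd hn bd.
  have /fsubsetPn[w wG wA] : ~~ (G `<=` A).
    by apply/negP=> /fsubset_leq_card; rewrite cA (uniform_sphere hn SG).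
  have sAGw : A `<=` G `\ w by rewrite fsubsetD1 sAG wA.
  have eA : A = G `\ w.
    apply/eqP; rewrite eqEfcard sAGw cA /=.
    by have := cardfsD1 w G; rewrite wG (uniform_sphere hn SG) add1n => -[<-].
  have [H [SH wH sGH]] := cl G w SG wG; rewrite -eA in sGH.
  case: (sphere_tetra SH) => [BH|BH|CH].
  - by move: wH; rewrite (uG H BH sGH) wG.
  (* The neighbour is in the antipodal ball, so [A] bounds both balls and is coned from both new
     vertices. To apply [shared] to antipodes, [G] must be outside the antipodal ball. *)
  - have nBG : ~ tetra (ball n) (neg_face G).
      case: BG => p q r s h eG /tetra_neg[p' q' r' s' h' eG'].
      have so' : (`|p'| < `|q'|) && (`|q'| < `|r'| < `|s'|).
        by have := ball_sorted hn h'; rewrite !normrN.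
      have e : [fset p; q; r; s] = [fset p'; q'; r'; s'] by rewrite -eG.
      have [ep eq er es] := fset4_inj (ball_sorted hn h) so' e; subst.
      by split_hyps; lia.
    have bd' : triangle (ball_bd n) (neg_face A).
      rewrite eA neg_faceD1; apply: (shared _ (neg_face H)) => //.
      + exact: tetra_sphere_neg.
      + by rewrite in_neg_face opprK.
      by rewrite -neg_faceD1 -eA neg_faceS.
    exists (- (n + 1) |` A); rewrite fsubsetUr; split=> //.
      by apply/tetra_sphere_succ=> //; constructor 3; exists A.
    by rewrite !inE negb_or nA andbT; lia.
  exists H; split=> //; first by apply/tetra_sphere_succ=> //; constructor 1.
  by apply/negP=> /(sphere_bound hn SH); lia.
have Sneg := @tetra_sphere_neg (n + 1).
move=> G v /(tetra_sphere_succ _ hn)[CG|[A bd ->]|[A bd ->]]; 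
  [exact: type1 | exact: type2 |].
(* Facets with apex [- (n + 1)] reduce to [type2] by the antipodal map. *)
apply: closed_neg; first exact: Sneg.
move=> w; rewrite neg_faceU1 opprK; exact: type2.
Qed.

Lemma ridge_closed4 : ridge_closed (tetra (sphere 4)).
Proof.
have norm4 p q r s : sphere 4 p q r s ->
    [/\ `|p| = 1, `|q| = 2, `|r| = 3 & `|s| = 4].
  by case/sphere_sorted=> //; split; lia.
move=> _ v [p q r s /norm4[hp hq hr hs] ->]; rewrite !inE -!orbA.
case/or4P=> /eqP->.
- exists [fset - p; q; r; s]; split.
    by exists (- p) q r s => //; apply: sphere4; lia.
    by rewrite !inE; lia.
  by apply/fsubsetP=> w; rewrite !inE; lia.
- exists [fset p; - q; r; s]; split.
    by exists p (- q) r s => //; apply: sphere4; lia.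
    by rewrite !inE; lia.
  by apply/fsubsetP=> w; rewrite !inE; lia.
- exists [fset p; q; - r; s]; split.
    by exists p q (- r) s => //; apply: sphere4; lia.
    by rewrite !inE; lia.
  by apply/fsubsetP=> w; rewrite !inE; lia.
exists [fset p; q; r; - s]; split.
    by exists p q r (- s) => //; apply: sphere4; lia.
  by rewrite !inE; lia.
by apply/fsubsetP=> w; rewrite !inE; lia.
Qed.

(** * Enumeration of the hemisphere by codes *)

Lemma step_hemisphere n l i p q r s R N : 4 <= n -> step_at n l i p q r s R N ->
  hemisphere n p q r s.
Proof. by move=> hn h; split_hyps; fin. Qed.

(** [l + l - 5] is the size of block [l]: the [2 (l - 3) - 1] edges of a path and two more facets,
    also for [l = n + 1]; the three facets of block 4 fit the same formula. *)
Lemma step_range n l i p q r s R N : 4 <= n -> step_at n l i p q r s R N ->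
  4 <= l <= n + 1 /\ 0 <= i < l + l - 5.
Proof. by move=> hn h; split_hyps; lia. Qed.

Lemma hemisphere_step n p q r s : 4 <= n -> hemisphere n p q r s ->
  exists l i R N, step_at n l i p q r s R N.
Proof.
(* The value [n - 3] of [p] separates [StepFirst] from [StepBallUp]. *)
move=> hn h; have [hp|hp] : p = n - 3 \/ p <> n - 3 by lia.
all: split_hyps; do 4 eexists.
all: first [by eapply StepFirst; try reflexivity; lia
  | by eapply StepBallUp; try reflexivity; lia
  | by eapply StepBallMid; try reflexivity; lia
  | by eapply StepBallDown; try reflexivity; lia
  | by eapply StepBallTop; try reflexivity; lia
  | by eapply StepBallBot; try reflexivity; lia
  | by eapply StepRestDown; try reflexivity; lia
  | by eapply StepRestMid; try reflexivity; lia
  | by eapply StepEdgeUp; try reflexivity; lia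
  | by eapply StepEdgeMid; try reflexivity; lia
  | by eapply StepEdgeDown; try reflexivity; lia
  | by eapply StepC1; try reflexivity; lia
  | by eapply StepC2; try reflexivity; lia
  | by eapply StepC3; try reflexivity; lia].
Qed.

Lemma step_unique n l i p q r s R N p' q' r' s' R' N' : 4 <= n ->
  step_at n l i p q r s R N -> step_at n l i p' q' r' s' R' N' ->
  [/\ p = p', q = q', r = r' & s = s'].
Proof.
by move=> hn h h'; destruct h, h'; first [exfalso; lia | split; lia].
Qed.

Lemma step_exists n l i : 4 <= n -> 4 <= l <= n + 1 -> 0 <= i < l + l - 5 ->
  exists p q r s R N, step_at n l i p q r s R N.
Proof.
move=> hn hl hi; have [hl4|[hl5|hl6]] : l = 4 \/ l = n + 1 \/ 5 <= l <= n by lia.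
- have [h|[h|h]] : i = 0 \/ i = 1 \/ i = 2 by lia.
  + by exists 1, (-2), 3, (-4); do 2 eexists; apply: StepC1; lia.
  + by exists 1, 2, 3, (-4); do 2 eexists; apply: StepC2; lia.
  by exists 1, 2, (-3), 4; do 2 eexists; apply: StepC3; lia.
- have [h|[h|[h|[h|[h|h]]]]] : i = 0 \/ 0 < i < n - 3 \/ i = n - 3 \/
      n - 3 < i < n + n - 5 \/ i = n + n - 5 \/ i = n + n - 4 by lia.
  + by exists (n - 3), (n - 2), (n - 1), n; do 2 eexists; apply: StepFirst; lia.
  + exists (n - 3 - i), (n - 2 - i), (n - 1), n; do 2 eexists.
    by apply: StepBallUp; lia.
  + by exists 1, (2 - n), (n - 1), n; do 2 eexists; apply: StepBallMid; lia.
  + exists (i + 5 - n - n), (i + 4 - n - n), (n - 1), n; do 2 eexists.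
    by apply: StepBallDown; lia.
  + by exists 1, (2 - n), (1 - n), n; do 2 eexists; apply: StepBallTop; lia.
  by exists 1, (2 - n), (1 - n), (- n); do 2 eexists; apply: StepBallBot; lia.
have [h|[h|[h|[h|h]]]] : i = 0 \/ i = 1 \/ 1 < i < l - 2 \/ i = l - 2 \/
  l - 2 < i < l + l - 5 by lia.
- exists (3 - l), (2 - l), (1 - l), l; do 2 eexists.
  by apply: StepRestDown; lia.
- by exists 1, (3 - l), (1 - l), l; do 2 eexists; apply: StepRestMid; lia.
- exists (l - 2 - i), (l - 1 - i), (l - 2), l; do 2 eexists.
  by apply: StepEdgeUp; lia.
- by exists 1, (3 - l), (l - 2), l; do 2 eexists; apply: StepEdgeMid; lia.
exists (i + 5 - l - l), (i + 4 - l - l), (l - 2), l; do 2 eexists.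
by apply: StepEdgeDown; lia.
Qed.

Lemma step_split n l i p q r s R N : 4 <= n -> step_at n l i p q r s R N ->
  all (mem [:: p; q; r; s]) R /\
  all (fun x => (x \notin R) && (x \in [:: p; q; r; s])) N.
Proof.
by move=> hn h; split_hyps; rewrite /= !inE; split; lia.
Qed.

(** * The facets of [Delta 3 n] *)

Lemma ridge_closed_sphere (n : nat) : (4 <= n)%N -> ridge_closed (tetra (sphere n)).
Proof.
elim: n => // n IHn; rewrite leq_eqVlt => /orP[/eqP <-|]; first exact: ridge_closed4.
rewrite ltnS => hn; have := ridge_closed_succ _ (IHn hn).
by rewrite -PoszD addn1; apply; lia.
Qed.

(** A ridge in a single facet of the ball cannot be interior: its second facet in the sphere would
    then be in the ball too. *)
Lemma boundary_ball n A : 4 <= n -> ridge_closed (tetra (sphere n)) ->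
  (exists G, [/\ tetra (ball n) G, A `<=` G, 4%N = #|` A|.+1 &
     forall H, tetra (ball n) H -> A `<=` H -> H = G]) <->
  triangle (ball_bd n) A.
Proof.
move=> hn cl; split=> [[G [BG sAG [cA] uG]]|bd]; last first.
  by have [G [BG sAG uG]] := bd_facet hn bd; exists G; rewrite (card_bd hn bd).
have SG := ball_sphere BG.
have /fsubsetPn[v vG vA] : ~~ (G `<=` A).
  by apply/negP=> /fsubset_leq_card; rewrite -cA (uniform_sphere hn SG).
have eA : A = G `\ v.
  apply/eqP; rewrite eqEfcard fsubsetD1 sAG vA /= -cA.
  by have := cardfsD1 v G; rewrite vG (uniform_sphere hn SG) add1n => -[<-].
rewrite eA in uG *; case: (ball_ridge hn BG vG) => // int_v.
have [H [SH vH sGH]] := cl G v SG vG.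
by move: vH; rewrite (uG H (int_v H SH sGH) sGH) vG.
Qed.

Lemma spanned_Delta n : (4 <= n)%N -> spanned (Delta 3 n) (tetra (sphere n)).
Proof.
elim: n => // n IHn; rewrite leq_eqVlt => /orP[/eqP <-|].
  by rewrite Delta_crossE //; exact: spanned_cross4.
rewrite ltnS => hn; have spD := IHn hn; rewrite Delta_replaceE //.
have hn' : 4 <= n%:Z by lia.
have cl := ridge_closed_sphere hn.
have spB : spanned (B 3 (uphalf 3).-1 n) (tetra (ball n)) by apply: spanned_B31.
have spN := spanned_neg spB.
have cS := uniform_sphere hn'; have cB := uniform_ball hn'.
have cN : uniform 4 (fun G => tetra (ball n) (neg_face G)).
  by move=> G /cB; rewrite card_neg_face.
rewrite /replace_balls; set BB := B 3 _ n in spB spN *.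
have spDiff := spanned_diffc spD cS (BB `|` neg_complex BB).
have spBd := spanned_cone n.+1%:Z (spanned_boundary spB cB).
have spBd' := spanned_cone (- n.+1%:Z) (spanned_boundary spN cN).
apply: eq_spanned (spannedU (spannedU spDiff spBd) spBd') => G.
have -> : n.+1%:Z = n%:Z + 1 by rewrite -PoszD addn1.
rewrite (tetra_sphere_succ _ hn').
have core_iff : tetra (core n) G <->
    tetra (sphere n) G /\ G \notin BB `|` neg_complex BB.
  have memB := uniform_mem cS spB cB; have memN := uniform_mem cS spN cN.
  split=> [CG|[SG]].
    have SG := core_tetra CG; have [nB nN] := core_not_tetra hn' CG.
    by split=> //; rewrite in_fsetU; apply/norP; split; apply/negP;
      [move/memB | move/memN] => /(_ SG).
  rewrite in_fsetU => /norP[/negP nB /negP nN].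
  case: (sphere_tetra SG) => // BG.
    by case: nB; apply/memB.
  by case: nN; apply/memN.
have bd A := boundary_ball A hn' cl.
have bd' A : (exists G, [/\ tetra (ball n) (neg_face G), A `<=` G, 4%N = #|` A|.+1 &
     forall H, tetra (ball n) (neg_face H) -> A `<=` H -> H = G]) <->
    triangle (ball_bd n) (neg_face A).
  rewrite -bd; split=> -[H [BH sAH cA uH]]; exists (neg_face H).
    split; rewrite ?neg_faceS ?card_neg_face // => X BX sAX.
    by rewrite -(uH (neg_face X)) ?neg_faceK // -neg_faceS neg_faceK.
  split; rewrite ?neg_faceK -?[A `<=` _]neg_faceS ?neg_faceK //.
    by rewrite -card_neg_face.
  move=> X BX sAX; rewrite -(uH (neg_face X)) ?neg_faceK ?neg_faceS //.
split.
  case=> [[/core_iff CG|[A /bd bA eG]]|[A /bd' bA eG]].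
  - by constructor 1.
  - by constructor 2; exists A.
  by constructor 3; exists A.
case=> [CG|[A /bd bA eG]|[A /bd' bA eG]].
- by left; left; apply/core_iff.
- by left; right; exists A.
by right; exists A.
Qed.

(** * The order of the codes and the resulting shelling *)

(** The admissible pairs (l, i) of [step_at], in the order of [F]. *)
Definition codes n : seq (nat * nat) :=
  [seq (l, i) | l <- rev (iota 4 (n - 2)), i <- iota 0 (l + l - 5)].

Definition code_lt (c c' : nat * nat) :=
  ((c'.1 < c.1) || (c.1 == c'.1) && (c.2 < c'.2))%N.

Lemma mem_codes n l i : (4 <= n)%N ->
  ((l, i) \in codes n) = (4 <= l <= n.+1)%N && (i < l + l - 5)%N.
Proof.
move=> hn; apply/allpairsPdep/andP => [[l' [i' [hl hi [-> ->]]]]|[hl hi]].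
  move: hl hi; rewrite mem_rev !mem_iota; lia.
by exists l, i; rewrite mem_rev !mem_iota; split=> //; lia.
Qed.

Lemma pairwise_codes n : pairwise code_lt (codes n).
Proof.
rewrite /codes.
have : pairwise gtn (rev (iota 4 (n - 2))).
  rewrite -sorted_pairwise; last by move=> x y z /= h1 h2; apply: ltn_trans h1.
  by rewrite rev_sorted; exact: iota_ltn_sorted.
elim: (rev _) => //= l ls IHls /andP[/allP ltl /IHls {}IHls].
rewrite pairwise_cat IHls andbT; apply/andP; split.
  apply/allrelP => _ c /mapP[i _ ->] /allpairsPdep[l' [i' [/ltl /= hl _ ->]]].
  by rewrite /code_lt /= hl.
rewrite pairwise_map; apply: (@sub_pairwise _ ltn).
  by move=> i j; rewrite /= /code_lt /= eqxx ltnn.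
by rewrite -sorted_pairwise; [exact: iota_ltn_sorted | exact: ltn_trans].
Qed.

(** [step_exists] gives mere existence for each code; along a finite list the faces can be collected
    into one sequence. *)
Lemma choose_seq (T : eqType) (x0 : T) (s : seq T) (Q : T -> face -> Prop) :
  (forall x, x \in s -> exists G, Q x G) ->
  exists2 F : seq face, size F = size s &
    forall t, (t < size s)%N -> Q (nth x0 s t) (nth fset0 F t).
Proof.
elim: s => [|x s IHs] Qs; first by exists [::].
have [|F sF QF] := IHs; first by move=> y ys; apply: Qs; rewrite inE ys orbT.
have [G QG] := Qs x (mem_head _ _).
by exists (G :: F) => [|[|t] lt]; rewrite /= ?sF //; apply: QF.
Qed.

Theorem theorem8p1 (n : nat) (hn : (4 <= n)%N) :
  exists F : seq face,
    shelling_order 3 (Delta 3 n) (F ++ rev [seq neg_face A | A <- F]).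
Proof.
have hn' : 4 <= n%:Z by lia.
pose placed (c : nat * nat) G := exists p q r s R N,
  step_at n c.1 c.2 p q r s R N /\ G = [fset p; q; r; s].
have [c cn|F sF QF] := @choose_seq _ (0, 0)%N (codes n) placed.
  case: c cn => l i; rewrite mem_codes // => h.
  have [|||p [q [r [s [R [N h']]]]]] := @step_exists n l i; try lia.
  by exists [fset p; q; r; s], p, q, r, s, R, N.
have memF G : G \in F <-> tetra (hemisphere n) G.
  split=> [/(nthP fset0)[t]|[p q r s]].
    rewrite sF => lt <-; have [p [q [r [s [R [N [h ->]]]]]]] := QF t lt.
    by exists p q r s => //; apply: step_hemisphere h.
  move=> /(hemisphere_step hn')[l [i [R [N h]]]] ->.
  have [hl hi] := step_range hn' h.
  (* Codes are natural numbers while [step_at] takes integers; by [step_range] both parameters are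
     nonnegative. [step_unique] then identifies the face chosen for this code. *)
  have /(nthP (0, 0)%N)[t lt et] : (`|l|%N, `|i|%N) \in codes n.
    by rewrite mem_codes //; lia.
  have := QF t lt; rewrite et => -[p' [q' [r' [s' [R' [N' [/= h' e']]]]]]].
  have el : `|l|%N%:Z = l by lia.
  have ei : `|i|%N%:Z = i by lia.
  rewrite el ei in h'; have [ep eq er es] := step_unique hn' h h'.
  by rewrite ep eq er es -e' mem_nth // sF.
have lt_codes u t : (u < t)%N -> (t < size F)%N ->
    code_lt (nth (0, 0)%N (codes n) u) (nth (0, 0)%N (codes n) t).
  move=> ltut lt; apply: (pairwiseP _ (pairwise_codes n)) => //;
    by rewrite inE -sF //; apply: ltn_trans lt.
exists F; apply: (@symmetric_shelling 3 _ (tetra (sphere n))).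
- exact: spanned_Delta.
- exact: uniform_sphere.
- move=> G; rewrite !memF; split=> [[p q r s [h|h] ->]|[[p q r s h ->]|]].
  + by left; exists p q r s.
  + by right; apply/tetra_neg; exists p q r s.
  + by exists p q r s => //; left.
  by move/tetra_neg=> [p q r s h ->]; exists p q r s => //; right.
- exact: ridge_closed_sphere.
- move=> t lt G; have := QF t; rewrite -sF => /(_ lt).
  case=> p [q [r [s [R [N [h eG]]]]]]; have [sR sN] := step_split hn' h.
  have {}eG : G = [fset p; q; r; s] := eG.
  have sub (X : seq int) (Y : face) : [fset x in X] `<=` Y = all (mem Y) X.
    by apply/fsubsetP/allP => sXY x xX; apply: sXY; move: xX; rewrite !inE.
  (* A face containing [G \ R] contains [N], which [step_after] and [step_opp] exclude. *)
  have sND : [fset x in N] `<=` G `\` [fset x in R].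
    rewrite sub; apply/allP=> x /(allP sN); rewrite eG !inE -!orbA => /andP[-> ->].
    by [].
  have inG (p' q' r' s' : int) (X : seq int) : [fset x in X] `<=` [fset p'; q'; r'; s'] ->
      all (mem [:: p'; q'; r'; s']) X.
    by rewrite sub => /allP sX; apply/allP=> x /sX; rewrite !inE -!orbA.
  exists [fset x in R]; split.
  + rewrite sub; apply/allP=> x /(allP sR); by rewrite eG !inE -!orbA.
  + move=> u ltut; apply/negP; have := QF u; rewrite -sF.
    move=> /(_ (ltn_trans ltut lt))[p' [q' [r' [s' [R' [N' [h' ->]]]]]]] /inG.
    apply: (step_before hn' h h').
    move: (lt_codes u t ltut lt); rewrite /code_lt.
    by move: (nth _ _ t) (nth _ _ u) => [l i] [l' i'] /=; lia.
  + move=> u /andP[ltu lu]; apply/negP; have := QF u; rewrite -sF.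
    move=> /(_ lu)[p' [q' [r' [s' [R' [N' [h' ->]]]]]]] /(fsubset_trans sND) /inG.
    apply: (step_after hn' h h').
    move: (lt_codes t u ltu lu); rewrite /code_lt.
    by move: (nth _ _ t) (nth _ _ u) => [l i] [l' i'] /=; lia.
  move=> u lu; apply/negP; have := QF u; rewrite -sF.
  move=> /(_ lu)[p' [q' [r' [s' [R' [N' [h' ->]]]]]]].
  rewrite neg_fset4 => /(fsubset_trans sND) /inG.
  exact: (step_opp hn' h h').
have : (4, 0)%N \in codes n by rewrite mem_codes //; lia.
by rewrite sF; case: (codes n).
Qed.
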